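(* Let $r \geq 2$ be an integer, $m = r^{\binom{r+1}{2}} - \lfloor r/4 \rfloor \cdot r^{\binom{r}{2}} + 1$ and $n = \left\lceil \frac12 \cdot r^{\binom{r+1}{2}} \right\rceil$. Then $g(m,n) \geq r+1$. In particular, $G(r) \leq r^{\binom{r+1}{2}} - \left(\frac14 - o(1)\right) r^{\binom{r}{2}+1}$, where $o(1)$ denotes a quantity tending to $0$ as $r \to \infty$.
   Context: For positive integers $m,n$, the grid graph $\Gamma_{m,n} = K_m \times K_n$ has vertex set $[m]\times[n]$ (where $[k]=\{1,\dots,k\}$), and two distinct vertices $(i,j)$, $(i',j')$ are adjacent if and only if $i=i'$ or $j=j'$. A rectangle is a set of four vertices $\{(i,j),(i',j),(i,j'),(i',j')\}$ with $1\le i<i'\le m$ and $1\le j<j'\le n$. Given a colouring of $E(\Gamma_{m,n})$, a rectangle is called alternating if its parallel edges receive the same colour, that is, the edges $\{(i,j),(i',j)\}$ and $\{(i,j'),(i',j')\}$ have the same colour, and the edges $\{(i,j),(i,j')\}$ and $\{(i',j),(i',j')\}$ have the same colour. An $r$-colouring is an arbitrary (not necessarily proper) assignment of colours from a set of $r$ colours. For positive integers $m,n$, $g(m,n)$ is the smallest number $r$ such that there exists an $r$-colouring of $E(\Gamma_{m,n})$ without alternating rectangles. $G(r)$ is the smallest number $n$ such that every $r$-colouring of $E(\Gamma_{n,n})$ induces an alternating rectangle. *)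

(* Defs.v *)
From mathcomp Require Import all_boot.

Set Implicit Arguments.
Unset Strict Implicit.
Unset Printing Implicit Defensive.

Definition vertex (m n : nat) : finType := ('I_m * 'I_n)%type.

Definition adj (m n : nat) : rel (vertex m n) :=
  [rel u v | (u != v) && ((u.1 == v.1) || (u.2 == v.2))].

Definition edges (m n : nat) : {set {set vertex m n}} :=
  [set e | [exists u, exists v, adj u v && (e == [set u; v])]].

Definition edge (m n : nat) : finType := {e : {set vertex m n} | e \in edges m n}.

Definition colouring (m n r : nat) : finType := {ffun edge m n -> 'I_r}.

(* The colour of the edge {u, v}; it is [None] exactly when {u, v} is not an
   edge, which never happens for the sides of a rectangle (lemmas [col_edge],
   [adj_col] and [adj_row] below). *)
Definition col (m n r : nat) (c : colouring m n r) (u v : vertex m n) :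
    option 'I_r :=
  omap c (insub [set u; v]).

Definition alternating (m n r : nat) (c : colouring m n r)
    (i i' : 'I_m) (j j' : 'I_n) : bool :=
  (col c (i, j) (i', j) == col c (i, j') (i', j'))
  && (col c (i, j) (i, j') == col c (i', j) (i', j')).

Definition has_alternating (m n r : nat) (c : colouring m n r) : bool :=
  [exists i : 'I_m, exists i' : 'I_m, exists j : 'I_n, exists j' : 'I_n,
     [&& i < i', j < j' & alternating c i i' j j']].

Definition avoidable (m n r : nat) : bool :=
  [exists c : colouring m n r, ~~ has_alternating c].

Definition unavoidable (r n : nat) : bool :=
  [forall c : colouring n n r, has_alternating c].

Lemma col_edge m n r (c : colouring m n r) u v :
  adj u v -> exists2 e : edge m n, val e = [set u; v] & col c u v = Some (c e).
Proof.
move=> uv; have He : [set u; v] \in edges m n.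
  by rewrite inE; apply/existsP; exists u; apply/existsP; exists v; rewrite uv /=.
by exists (Sub [set u; v] He); rewrite ?SubK // /col insubT.
Qed.

Lemma adj_col m n (i i' : 'I_m) (j : 'I_n) : i < i' -> adj (i, j) (i', j).
Proof.
move=> lt_i; rewrite /adj /= eqxx orbT andbT xpair_eqE eqxx andbT.
by rewrite -(inj_eq val_inj) neq_ltn lt_i.
Qed.

Lemma adj_row m n (i : 'I_m) (j j' : 'I_n) : j < j' -> adj (i, j) (i, j').
Proof.
move=> lt_j; rewrite /adj /= eqxx andbT xpair_eqE eqxx /=.
by rewrite -(inj_eq val_inj) neq_ltn lt_j.
Qed.

Lemma avoidable_ex m n : exists r, avoidable m n r.
Proof.
exists #|{: edge m n}|; apply/existsP.
exists [ffun e => enum_rank e]; apply/negP.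
case/existsP=> i /existsP[i' /existsP[j /existsP[j' /and3P[lt_i lt_j /andP[]]]]].
set c := [ffun e => _].
have [e1 E1 ->] := col_edge c (adj_col j lt_i).
have [e2 E2 ->] := col_edge c (adj_col j' lt_i).
move=> /eqP[]; rewrite !ffunE => /enum_rank_inj e12 _.
have: (i, j) \in [set (i, j'); (i', j')] by rewrite -E2 -e12 E1 set21.
by rewrite !inE !xpair_eqE -!(inj_eq val_inj) /= (ltn_eqF lt_j) !andbF.
Qed.

Lemma noninj_lt n (T : finType) (f : 'I_n -> T) :
  #|T| < n -> exists i : 'I_n, exists2 j : 'I_n, i < j & f i = f j.
Proof.
move=> ltTn; have /injectivePn[i [j ne_ij eqf]] : ~~ injectiveb f.
  by apply/negP=> /injectiveP/leq_card; rewrite card_ord leqNgt ltTn.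
case: (ltngtP i j) => [lt|lt|eq]; first by exists i; exists j.
  by exists j; exists i.
by rewrite (val_inj eq) eqxx in ne_ij.
Qed.

Lemma unavoidable_ex r : exists n, unavoidable r n.
Proof.
pose T : finType := {ffun 'I_r.+2 * 'I_r.+2 -> option 'I_r}.
pose n := (r.+2 + #|T|.+1)%N; exists n.
apply/forallP=> c; pose w : 'I_r.+2 -> 'I_n := lshift _.
have ltT : #|T| < n by rewrite /n addnS ltnS leq_addl.
have [j [j' lt_j /ffunP eq_j]] := noninj_lt
  (fun j => [ffun p => col c (w p.1, j) (w p.2, j)] : T) ltT.
have ltO : #|{: option 'I_r}| < r.+2 by rewrite card_option card_ord.
have [a [b lt_ab eq_ab]] := noninj_lt (fun a => col c (w a, j) (w a, j')) ltO.
apply/existsP; exists (w a); apply/existsP; exists (w b).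
apply/existsP; exists j; apply/existsP; exists j'.
rewrite lt_j lt_ab /alternating eq_ab eqxx andbT /=.
by have := eq_j (a, b); rewrite !ffunE => ->.
Qed.

Definition g (m n : nat) : nat := ex_minn (avoidable_ex m n).

Definition G (r : nat) : nat := ex_minn (unavoidable_ex r).

(* Main.v *)
(** Call the vertices with first coordinate [i] the column [i].  A column of a
    colouring induces an edge colouring [A i] of the complete graph on the rows.
    If there is no alternating rectangle, two columns cannot induce the same
    colouring on [r + 1] rows: by pigeonhole, two of the [r + 1] edges joining
    these columns have the same colour.  This bounds the number of columns by
    [r ^ 'C(r + 1, 2)], which is enough for [r < 4].

    For [r >= 4] fix a set [Q] of [r - 1] rows and a large set [U] of columns
    that induce the same colouring on [Q], and put [q = r ^ (r - 1)].  Every row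
    [v] outside [Q] splits [U] into at most [q] classes, according to the
    colours of the edges between [v] and [Q].  Hence two columns of [U] are, on
    average, in the same class for at least about a fraction [1 / q] of the rows
    [v].  On the other hand, for two rows [v] and [w] the common refinement of
    the two partitions has classes of size at most [r], since the columns in one
    class have pairwise distinct colours at the edge [{v, w}].  Comparing the
    first and second moments of the number of coincidences over pairs of
    distinct columns gives roughly [#|U| <= (r - 1) * q ^ 2], whereas [U] can be
    chosen with [#|U| > r * q ^ 2 - (r %/ 4) * q]. *)

Require Import Defs.
From mathcomp Require Import all_boot all_order all_algebra.
From mathcomp Require Import zify ring lra.
Import Order.TTheory GRing.Theory Num.Theory.

Set Implicit Arguments.
Unset Strict Implicit.
Unset Printing Implicit Defensive.

(** * Averaging and second moments of coincidences *)

Lemma pigeonhole_fibre (X T : finType) (f : X -> T) :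
  0 < #|T| -> exists t, #|X| <= #|T| * #|[set x | f x == t]|.
Proof.
move=> T0; have [t0 _] := card_gt0P T0.
pose t := [arg max_(t > t0) #|[set x | f x == t]|]; exists t.
have -> : #|X| = (\sum_t' #|[set x | f x == t']|)%N.
  rewrite -sum1_card (partition_big f predT) //=.
  by apply: eq_bigr => t' _; rewrite -sum1_card; apply: eq_bigl => x; rewrite inE.
rewrite -sum_nat_const; apply: leq_sum => t' _.
by rewrite /t; case: arg_maxnP => // s _; apply.
Qed.

Section SecondMoment.
Local Open Scope ring_scope.

Variables (X J T : finType) (U : {set X}) (V : {set J}) (F : J -> X -> T).

Let agree v i i' : int := (F v i == F v i')%:R.

(** Cauchy-Schwarz: the double sum equals the sum of the squared class sizes of [F v] on [U]. *)
Lemma sum_agree_ge v :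
  #|U|%:R ^+ 2 <= #|T|%:R * \sum_(i in U) \sum_(i' in U) agree v i i'.
Proof.
pose s t : int := \sum_(i in U) (F v i == t)%:R.
have sum_s : \sum_t s t = #|U|%:R.
  rewrite exchange_big /= -sum1_card natr_sum; apply: eq_bigr => i _.
  by rewrite (bigD1 (F v i)) //= eqxx big1 ?addr0 // => t; rewrite eq_sym => /negbTE->.
have -> : \sum_(i in U) \sum_(i' in U) agree v i i' = \sum_t s t ^+ 2.
  under [RHS]eq_bigr do rewrite expr2 mulr_suml.
  rewrite [RHS]exchange_big /=; apply: eq_bigr => i _.
  rewrite [RHS](bigD1 (F v i)) //= eqxx mul1r [X in _ = _ + X]big1 ?addr0 => [|t]; last first.
    by rewrite eq_sym => /negbTE->; rewrite mul0r.
  by apply: eq_bigr => i' _; rewrite /agree eq_sym.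
have [T0|T0] := posnP #|T|.
  suff -> : #|U| = 0%N by rewrite expr0n /= T0 mul0r.
  by apply/eqP; rewrite cards_eq0; apply/set0Pn => -[i _]; case: (fintype0 (F v i)).
have: 0 <= \sum_t (#|T|%:R * s t - #|U|%:R) ^+ 2 by apply: sumr_ge0 => t _; apply: sqr_ge0.
have -> : \sum_t (#|T|%:R * s t - #|U|%:R) ^+ 2 =
   #|T|%:R * (#|T|%:R * (\sum_t s t ^+ 2) - #|U|%:R ^+ 2).
  transitivity (\sum_t (#|T|%:R ^+ 2 * s t ^+ 2 - 2 * #|T|%:R * #|U|%:R * s t + #|U|%:R ^+ 2)).
    by apply: eq_bigr => t _; ring.
  rewrite big_split sumrB /= -!mulr_sumr sum_s GRing.sumr_const -mulr_natl.
  by rewrite cardT -cardE; ring.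
by rewrite pmulr_rge0 ?subr_ge0 // ltr0n.
Qed.

(** Sum [(q * d i i' - n) ^+ 2] over all pairs from [U], where [d i i'] counts coincidences: the
    diagonal bounds it from below, the two moments of [d] from above. *)
Lemma second_moment r : (0 < #|V|)%N -> (#|T| <= 2 * #|V|)%N -> (0 < #|U|)%N ->
  (forall v w i, v \in V -> w \in V -> v != w -> i \in U ->
     #|[set i' in U | (F v i == F v i') && (F w i == F w i')]| <= r)%N ->
  #|V|%:R * (#|U|%:R + 1 + #|T|%:R ^+ 2 - 2 * #|T|%:R - #|T|%:R ^+ 2 * r%:R)
    <= #|T|%:R * (#|U|%:R - r%:R * #|T|%:R) :> int.
Proof.
move=> V0 leTV U0 le_r; set q : int := #|T|%:R; set n : int := #|V|%:R; set y : int := #|U|%:R.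
pose d i i' := \sum_(v in V) agree v i i'.
pose D := \sum_(v in V) \sum_(i in U) \sum_(i' in U) agree v i i'.
have geD : n * y ^+ 2 <= q * D.
  rewrite /D mulr_sumr mulr_natl -GRing.sumr_const; apply: ler_sum => v _.
  exact: sum_agree_ge.
have sum_d : \sum_(i in U) \sum_(i' in U) d i i' = D.
  rewrite /D [RHS]exchange_big /=; apply: eq_bigr => i _.
  by rewrite exchange_big.
(* The terms with [v = w] give at most [D]; each ordered pair [v != w] gives at most [r * y]. *)
have sum_d2 : \sum_(i in U) \sum_(i' in U) d i i' ^+ 2 <= D + n * (n - 1) * (r%:R * y).
  have -> : \sum_(i in U) \sum_(i' in U) d i i' ^+ 2 =
      \sum_(v in V) \sum_(w in V) \sum_(i in U) \sum_(i' in U) agree v i i' * agree w i i'.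
    under [RHS]eq_bigr do rewrite exchange_big /=.
    rewrite [RHS]exchange_big /=; apply: eq_bigr => i _.
    under [RHS]eq_bigr do rewrite exchange_big /=.
    rewrite [RHS]exchange_big /=; apply: eq_bigr => i' _.
    by rewrite expr2 mulr_suml; apply: eq_bigr => v _; rewrite mulr_sumr.
  have -> : D + n * (n - 1) * (r%:R * y) = \sum_(v in V)
      (\sum_(i in U) \sum_(i' in U) agree v i i' + (n - 1) * (r%:R * y)).
    by rewrite big_split /= GRing.sumr_const -[(n - 1) * _ *+ _]mulr_natl -mulrA.
  apply: ler_sum => v Vv; rewrite (bigD1 v) //= lerD //.
    apply: ler_sum => i _; apply: ler_sum => i' _.
    by rewrite /agree; case: eqP.
  rewrite (_ : n - 1 = #|V :\ v|%:R); last first.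
    by rewrite /n (cardsD1 v V) Vv natrD addrC addKr.
  rewrite mulr_natl -GRing.sumr_const [leRHS](eq_bigl (fun w => (w \in V) && (w != v))); last first.
    by move=> w; rewrite !inE andbC.
  apply: ler_sum => w /andP[Vw wv].
  rewrite mulr_natr -GRing.sumr_const; apply: ler_sum => i Ui.
  rewrite eq_sym in wv; apply: le_trans (_ : #|[set i' in U | (F v i == F v i') && (F w i == F w i')]|%:R <= _).
    rewrite -sum1_card natr_sum big_mkcond [leRHS]big_mkcond /=.
    by apply: ler_sum => i' _; rewrite inE /agree; case: (i' \in U) => //=; do 2!case: eqP.
  by rewrite ler_nat le_r.
(* Only the pairs [i != i'] matter: the diagonal terms, where [d i i = n], are
   subtracted exactly, as they are too large to be absorbed. *)
have diag : y * (n * (q - 1)) ^+ 2 <= \sum_(i in U) \sum_(i' in U) (q * d i i' - n) ^+ 2.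
  rewrite mulr_natl -GRing.sumr_const; apply: ler_sum => i Ui.
  rewrite (bigD1 i) //= -[leLHS]addr0; apply: lerD.
    rewrite (_ : d i i = n) ?le_eqVlt; first by apply/orP; left; apply/eqP; ring.
    by rewrite /d /agree; under eq_bigr do rewrite eqxx; rewrite GRing.sumr_const.
  by apply: sumr_ge0 => ? _; apply: sqr_ge0.
have expand : \sum_(i in U) \sum_(i' in U) (q * d i i' - n) ^+ 2 =
   q ^+ 2 * (\sum_(i in U) \sum_(i' in U) d i i' ^+ 2) - 2 * q * n * D + n ^+ 2 * y ^+ 2.
  transitivity (\sum_(i in U) \sum_(i' in U) (q ^+ 2 * d i i' ^+ 2 - 2 * q * n * d i i' + n ^+ 2)).
    by apply: eq_bigr => i _; apply: eq_bigr => i' _; ring.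
  under eq_bigr do rewrite big_split sumrB /= -!mulr_sumr GRing.sumr_const.
  rewrite big_split sumrB /= -!mulr_sumr sum_d GRing.sumr_const.
  by rewrite -2!mulr_natr -/y; ring.
have n0 : 0 < n by rewrite ltr0n.
have y0 : 0 < y by rewrite ltr0n.
have q0 : 0 <= q by rewrite ler0n.
have leqn : q <= 2 * n by rewrite /q /n -natrM ler_nat.
rewrite expand in diag.
(* In total [D] has coefficient [- q * (2 * n - q)], nonpositive by [leqn], so the lower bound [geD]
   may be inserted. *)
have key : y * (n * (q - 1)) ^+ 2 <= q ^+ 2 * (n * (n - 1) * (r%:R * y))
   + (q - 2 * n) * (n * y ^+ 2) + n ^+ 2 * y ^+ 2.
  have : (2 * n - q) * (n * y ^+ 2) <= (2 * n - q) * (q * D) by apply: ler_wpM2l; rewrite ?subr_ge0.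
  have : q ^+ 2 * (\sum_(i in U) \sum_(i' in U) d i i' ^+ 2) <= q ^+ 2 * (D + n * (n - 1) * (r%:R * y)).
    by apply: ler_wpM2l => //; apply: sqr_ge0.
  lra.
have ny0 : 0 < n * y by apply: mulr_gt0.
rewrite -subr_ge0 -(pmulr_rge0 _ ny0).
by rewrite -subr_ge0 in key; congr (0 <= _) : key; ring.
Qed.

End SecondMoment.

(** Left minus right side increases with [y] as [q <= n]; at the least [y] it increases with [n].
    [h1] and [h2] insert the least values, and [h3] covers the leading term that remains. *)
Lemma moment_contradiction (n y q k r : nat) : 0 < r -> k.+2 < q ->
  r * q * q < n -> r * q * q < y + k * q ->
  ~ (n%:R * (y%:R + 1 + q%:R ^+ 2 - 2 * q%:R - q%:R ^+ 2 * r%:R)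
      <= q%:R * (y%:R - r%:R * q%:R) :> int)%R.
Proof.
move=> r1 kq nr yr; rewrite !natz.
have qq : q <= r * q * q by nia.
have nq : (0 <= n%:Z - q%:Z)%R by lia.
have h1 : (0 <= (n%:Z - q%:Z) * (y%:Z + k%:Z * q%:Z - r%:Z * q%:Z * q%:Z - 1))%R.
  by apply: mulr_ge0; lia.
have h2 : (0 <= (n%:Z - r%:Z * q%:Z * q%:Z - 1) * (2 + q%:Z * (q%:Z - k%:Z - 2)))%R.
  by apply: mulr_ge0; nia.
have h3 : (0 <= (r%:Z * q%:Z * q%:Z) * q%:Z * (q%:Z - k%:Z - 3))%R by apply: mulr_ge0; nia.
nia.
Qed.

Lemma exists_subset_of_card (J : finType) k : k <= #|J| -> exists S : {set J}, #|S| = k.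
Proof.
rewrite -bin_gt0 -card_draws => /card_gt0P[S].
by rewrite inE => /eqP; exists S.
Qed.

(** * Columns as edge colourings of the set of rows *)

Section Columns.

Variables (X J K : finType) (A : X -> {set J} -> K).

Definition pairs (S : {set J}) := [set e : {set J} | (e \subset S) && (#|e| == 2)].

Definition restr (S : {set J}) (i : X) : {ffun {e | e \in pairs S} -> K} :=
  [ffun e => A i (val e)].

Lemma card_restr S : #|{ffun {e | e \in pairs S} -> K}| = #|K| ^ 'C(#|S|, 2).
Proof. by rewrite card_ffun card_sig cards_draws. Qed.

Lemma restrP S i i' : reflect {in pairs S, A i =1 A i'} (restr S i == restr S i').
Proof.
apply: (iffP eqP) => [/ffunP eq_r e Se|eqA]; last first.
  by apply/ffunP => e; rewrite !ffunE; apply/eqA/valP.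
by have := eq_r (Sub e Se); rewrite !ffunE SubK.
Qed.

Hypothesis separated : forall (S : {set J}) i i',
  #|K| < #|S| -> {in pairs S, A i =1 A i'} -> i = i'.

Lemma card_columns_le : #|K| < #|J| -> #|X| <= #|K| ^ 'C(#|K|.+1, 2).
Proof.
move=> /exists_subset_of_card[S cardS]; rewrite -cardS -card_restr.
apply: (leq_card (restr S)) => i i' /eqP/restrP; apply: separated.
by rewrite cardS.
Qed.

Definition star (Q : {set J}) (v : J) (i : X) : {ffun {z | z \in Q} -> K} :=
  [ffun z => A i [set val z; v]].

Lemma card_star (Q : {set J}) : #|{ffun {z | z \in Q} -> K}| = #|K| ^ #|Q|.
Proof. by rewrite card_ffun card_sig. Qed.

Lemma starP (Q : {set J}) v i i' :
  reflect {in Q, forall z : J, A i [set z; v] = A i' [set z; v]} (star Q v i == star Q v i').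
Proof.
apply: (iffP eqP) => [/ffunP eq_r z Qz|eqA]; last first.
  by apply/ffunP => z; rewrite !ffunE; apply/eqA/valP.
by have := eq_r (Sub z Qz); rewrite !ffunE SubK.
Qed.

(** On [v], [w] and [Q], exactly [#|K|.+1] rows, two such columns can differ only at the pair
    [[set v; w]], so by [separated] the colour of that pair determines the column. *)
Lemma card_star_agree Q v w (phi : {ffun {e | e \in pairs Q} -> K}) i :
  #|Q|.+1 = #|K| -> v \notin Q -> w \notin Q -> v != w ->
  #|[set i' in [set x | restr Q x == phi] |
      (star Q v i == star Q v i') && (star Q w i == star Q w i')]| <= #|K|.
Proof.
move=> cardQ Qv Qw vw; set Z := [set i' in _ | _].
apply: leq_trans (_ : #|(fun i' => A i' [set v; w]) @: Z| <= _); last exact: max_card.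
rewrite card_in_imset // => x y.
rewrite !inE => /and3P[/eqP xphi /eqP xv /eqP xw] /and3P[/eqP yphi /eqP yv /eqP yw] eq_vw.
have {xphi yphi} /restrP eqQ : restr Q x == restr Q y by rewrite xphi yphi.
have {xv yv} /starP eqv : star Q v x == star Q v y by rewrite -xv -yv.
have {xw yw} /starP eqw : star Q w x == star Q w y by rewrite -xw -yw.
apply: (@separated (v |: (w |: Q))) => [|e Ke].
  by rewrite !cardsU1 !inE (negbTE vw) (negbTE Qv) Qw /= -cardQ.
move: Ke; rewrite inE => /andP[+ /cards2P[a [b [ab def_e]]]]; rewrite {}def_e => /subsetP sub_e.
have inU z : z \in [set a; b] -> [\/ z = v, z = w | z \in Q].
  move=> /sub_e/setU1P[]; first by constructor 1.
  by case/setU1P; [constructor 2|constructor 3].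
case: (inU a (set21 a b)) => [aE|aE|Qa]; case: (inU b (set22 a b)) => [bE|bE|Qb].
- by case/eqP: ab; rewrite aE bE.
- by rewrite aE bE.
- by rewrite aE setUC eqv.
- by rewrite aE bE setUC.
- by case/eqP: ab; rewrite aE bE.
- by rewrite aE setUC eqw.
- by rewrite bE eqv.
- by rewrite bE eqw.
apply: eqQ; rewrite inE cards2 ab eqxx andbT.
by apply/subsetP => z; rewrite !inE => /orP[]/eqP->.
Qed.

Lemma card_columns_lt k : 2 < #|K| -> k.+2 < #|K| ^ #|K|.-1 ->
  #|K| ^ 'C(#|K|.+1, 2) <= 2 * #|J| ->
  #|X| <= #|K| ^ 'C(#|K|.+1, 2) - k * #|K| ^ 'C(#|K|, 2).
Proof.
move=> K2; have [s cardK] : exists s, #|K| = s.+1.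
  by exists #|K|.-1; rewrite prednK // (ltn_trans _ K2).
rewrite cardK /= ltnS in K2 *; set q := s.+1 ^ s; set N := 'C(s, 2).
have binS1 : 'C(s.+1, 2) = N + s by rewrite binS bin1.
have binS2 : 'C(s.+2, 2) = N + s + s.+1 by rewrite binS bin1 binS1.
rewrite {}binS2 {}binS1 !expnD expnS -/q => ltk leJ.
rewrite leqNgt; apply/negP => ltX.
have q_gt : s < q by apply: ltn_expl; lia.
(* [#|J|] is at least half of [s.+1 ^ N * (s.+1 * q * q)]; the factor 3 keeps it above
   [s.+1 * q * q] even after the [s] rows of [Q] are removed. *)
have le3N : 3 <= s.+1 ^ N.
  have N0 : 0 < N by rewrite bin_gt0.
  by rewrite (leq_trans (_ : 3 <= s.+1 ^ 1)) ?leq_pexp2l ?expn1.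
have leJ3 : 3 * (s.+1 * q * q) <= 2 * #|J|.
  apply: leq_trans leJ; rewrite (_ : s.+1 ^ N * q * (s.+1 * q) = s.+1 ^ N * (s.+1 * q * q)) ?leq_mul //.
  ring.
have le_sq : s * 3 <= s.+1 * q * q.
  by rewrite -mulnA leq_mul // (leq_trans (_ : 3 <= q)) ?leq_pmulr; lia.
have [Q cardQ] : exists Q : {set J}, #|Q| = s.
  by apply: exists_subset_of_card; lia.
have [phi leX] : exists phi, #|X| <= s.+1 ^ N * #|[set i | restr Q i == phi]|.
  have := @pigeonhole_fibre _ _ (restr Q); rewrite card_restr cardQ cardK; apply.
  by rewrite expn_gt0.
set U := [set i | restr Q i == phi] in leX.
have cardQC : #|~: Q| = #|J| - s by rewrite cardsCs setCK cardQ.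
(* Divide [ltX] by [s.+1 ^ N], the number of possible restrictions to [Q]. *)
have leU : s.+1 * q * q < #|U| + k * q.
  rewrite -(ltn_pmul2l (_ : 0 < s.+1 ^ N)) ?expn_gt0 // mulnDr.
  have eqM : s.+1 ^ N * q * (s.+1 * q) = s.+1 ^ N * (s.+1 * q * q) by ring.
  have eqk : k * (s.+1 ^ N * q) = s.+1 ^ N * (k * q) by ring.
  by rewrite eqM eqk in ltX; have := leq_trans ltX leX; lia.
have le_kq : k * q <= q * q by rewrite leq_mul2r; lia.
have le_qq : q * q <= s.+1 * q * q by rewrite -mulnA leq_pmull.
have le_q : q <= q * q by rewrite leq_pmulr; lia.
have leV : s.+1 * q * q < #|~: Q| by rewrite cardQC; lia.
apply: (moment_contradiction _ ltk leV leU) => //.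
have := @second_moment _ _ _ U (~: Q) (star Q) s.+1.
rewrite card_star cardQ cardK -/q; apply; [lia|lia|lia|] => v w i.
rewrite !inE => Qv Qw vw _; rewrite -cardK.
by apply: card_star_agree; rewrite ?cardQ.
Qed.

End Columns.

(* Passing to [n <= N] rows and [r.+1 >= r'] colours gives both the monotonicity
   of [avoidable] in the colours needed for [g] and the square grids of [G]. *)
Lemma separated_colouring m n N r r' (c : colouring m N r') :
  n <= N -> r' <= r.+1 -> ~~ has_alternating c ->
  exists A : 'I_m -> {set 'I_n} -> 'I_r.+1, forall (S : {set 'I_n}) (i i' : 'I_m),
    #|'I_r.+1| < #|S| -> {in pairs S, A i =1 A i'} -> i = i'.
Proof.
move=> le_nN le_r noalt; pose w : 'I_n -> 'I_N := widen_ord le_nN.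
(* The default [ord0] never arises on two-element sets [e], since their images are edges. *)
pose A i (e : {set 'I_n}) : 'I_r.+1 :=
  odflt ord0 (omap (widen_ord le_r) (omap c (insub [set (i, w j) | j in e]))).
exists A => S; rewrite card_ord.
have AE i j j' : A i [set j; j'] = odflt ord0 (omap (widen_ord le_r) (Defs.col c (i, w j) (i, w j'))).
  by rewrite /A /Defs.col imsetU1 imset_set1.
move=> i i' ltS eqA; apply/eqP; apply: contraNT noalt => ne_i.
wlog lt_i : i i' eqA ne_i / i < i'.
  move=> hwlog; case: (ltngtP i i') => [|lt_i|eq_i]; first exact: hwlog.
    by apply: (hwlog i' i) => //; [move=> e Se; rewrite eqA | rewrite eq_sym].
  by rewrite (val_inj eq_i) eqxx in ne_i.
pose f j := Defs.col c (i, w j) (i', w j).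
have : ~~ dinjectiveb f S.
  apply/negP => /dinjectiveP/card_in_imset cardS.
  have : f @: S \subset Some @: [set: 'I_r'].
    apply/subsetP => _ /imsetP[j _ ->]; rewrite /f.
    by have [e _ ->] := col_edge c (adj_col (w j) lt_i); apply: imset_f; rewrite inE.
  move/subset_leq_card; rewrite cardS card_imset; last by move=> ? ? [].
  by rewrite cardsT card_ord leqNgt (leq_ltn_trans le_r).
case/dinjectivePn => j Sj [j'] => /andP[ne_j Sj'] eq_f.
wlog lt_j : j j' Sj Sj' ne_j eq_f / j < j'.
  move=> hwlog; case: (ltngtP j j') => [lt_j|lt_j|eq_j]; first exact: (hwlog j j').
    by apply: (hwlog j' j) => //; rewrite eq_sym.
  by move: ne_j; rewrite (val_inj eq_j) => /negP[]; apply: eqxx.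
apply/existsP; exists i; apply/existsP; exists i'.
apply/existsP; exists (w j); apply/existsP; exists (w j').
rewrite lt_i lt_j /alternating -/(f j) -/(f j') eq_f eqxx /=.
have /eqA : [set j; j'] \in pairs S.
  rewrite inE cards2 (eq_sym j) ne_j andbT.
  by apply/subsetP => z; rewrite !inE => /orP[]/eqP->.
have lt_w : w j < w j' by [].
rewrite !AE; have [e _ ->] := col_edge c (adj_row i lt_w).
have [e' _ ->] := col_edge c (adj_row i' lt_w).
by move=> /(congr1 val) /= eq_e; apply/eqP; congr Some; apply: val_inj.
Qed.

(** * The bounds on [g] and [G] *)

Lemma not_avoidable m n r r' : 2 <= r -> r' <= r ->
  r ^ 'C(r.+1, 2) - (r %/ 4) * r ^ 'C(r, 2) < m -> uphalf (r ^ 'C(r.+1, 2)) <= n ->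
  ~~ avoidable m n r'.
Proof.
(* From here [r.+1] stands for the former [r]. Through [len] only the required number of rows is
   kept, so the size conditions left depend on [r] alone. *)
case: r => // r r2 le_r ltm len; apply/existsP => -[c /(separated_colouring len le_r)[A separated]].
move: ltm; apply/negP; rewrite -leqNgt -[m in m <= _]card_ord.
have [le_r2|gt_r2] := leqP r 2.
  rewrite divn_small ?ltnS // mul0n subn0.
  have := card_columns_le separated; rewrite !card_ord; apply.
  by case: r r2 le_r2 {A le_r c len separated} => [|[|[|]]].
have := card_columns_lt separated; rewrite !card_ord; apply.
- by rewrite ltnS ltnW.
- apply: leq_trans (_ : r.+1 ^ 3 <= _); last by rewrite leq_pexp2l.
  by have := leq_div r.+1 4; rewrite !expnS expn0; nia.
- by rewrite mul2n -leq_uphalf_double.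
Qed.

Lemma leq_G r : 2 <= r -> G r + (r %/ 4) * r ^ 'C(r, 2) <= r ^ 'C(r.+1, 2) + 1.
Proof.
(* The subtracted term is at most a quarter of the main one, so the truncated subtraction in [m] is
   exact and [m] rows suffice for [not_avoidable]. *)
move=> r2; have le_k : r %/ 4 * r ^ 'C(r, 2) * 4 <= r ^ 'C(r.+1, 2).
  by rewrite binS bin1 addnC expnD mulnAC leq_mul // (leq_trans (leq_divM _ _)) // -{1}(expn1 r) leq_pexp2l //; lia.
rewrite /G; case: ex_minnP => n0 _ min_n0.
pose m := r ^ 'C(r.+1, 2) - (r %/ 4) * r ^ 'C(r, 2) + 1.
have : n0 <= m; last by rewrite /m; lia.
apply/min_n0/forallP => c; apply: contraT => noalt.
suff /negP[] : ~~ avoidable m m r by apply/existsP; exists c.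
apply: not_avoidable r2 (leqnn r) _ _; rewrite /m ?addn1 // leq_uphalf_double -mul2n.
by lia.
Qed.

From mathcomp Require Import all_classical all_reals all_analysis.
Import numFieldNormedType.Exports.
Local Open Scope classical_set_scope.
Local Open Scope ring_scope.

Theorem theorem1p3 (R : realType) :
  (forall r : nat, (2 <= r)%N ->
     (r.+1 <= g (r ^ 'C(r.+1, 2) - (r %/ 4) * r ^ 'C(r, 2) + 1)
                (uphalf (r ^ 'C(r.+1, 2))))%N)
  /\
  (exists eps : nat -> R,
     eps @ \oo --> (0 : R) /\
     forall r : nat, (2 <= r)%N ->
       (G r)%:R <= r%:R ^+ 'C(r.+1, 2)
                   - (1 / 4 - eps r) * r%:R ^+ ('C(r, 2) + 1)%N :> R).
Proof.
split=> [r r2|].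
  rewrite /g; case: ex_minnP => r' av _.
  rewrite ltnNge; apply: contraL av => le_r.
  by apply: not_avoidable r2 le_r _ _; rewrite ?addn1.
(* With [P = r ^ 'C(r, 2)], the floor costs at most [3 / 4 * P] and the extra 1 at most [P];
   [4 / (r + 1)] times [r * P] covers this [7 / 4 * P] once [2 <= r]. *)
exists (fun r => 4 * harmonic r); split.
  by rewrite -[X in _ --> X](mulr0 4); apply: cvgMl_tmp; apply: cvg_harmonic.
move=> r r2; have leG := leq_G r2.
have := leG; rewrite -(ler_nat R) natrD (natrD _ _ 1) natrM !natrX => {}leG.
have P1 : 1 <= r%:R ^+ 'C(r, 2) :> R by rewrite exprn_ege1 // ler1n ltnW.
have le4 : r%:R <= 4 * (r %/ 4)%:R + 3 :> R by rewrite -natrM -natrD ler_nat; lia.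
have le_eps : 7 / 4 <= 4 * harmonic r * r%:R :> R.
  rewrite /harmonic /= mulrAC ler_pdivlMr ?ltr0n // -natr1.
  by have : 2 <= r%:R :> R by [rewrite ler_nat]; lra.
rewrite exprD expr1.
move: leG P1 le4 le_eps; set P := r%:R ^+ 'C(r, 2); set k := (r %/ 4)%:R.
set e := 4 * harmonic r => leG P1 le4 le_eps.
have P0 : 0 <= P by apply: le_trans ler01 P1.
have h1 : P * r%:R <= P * (4 * k + 3) by apply: ler_wpM2l.
have h2 : P * (7 / 4) <= P * (e * r%:R) by apply: ler_wpM2l.
lra.
Qed.
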